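(* For every odd number $m\ge 3$ and every $n\ge 2$, $$\delta(C_m\times P_n)=\begin{cases} m/2, & \text{if } n-1\le m,\\ (n-1)/2, & \text{if } m<n-1<2m,\\ m-1/2, & \text{if } n-1\ge 2m.\end{cases}$$
   Context: $C_m$ denotes the cycle graph with $m$ vertices and $P_n$ the path graph with $n$ vertices. Every edge of a graph has length $1$, and a connected graph is regarded as a geodesic metric space by identifying each edge isometrically with $[0,1]$ and using the shortest-path distance (so its points are vertices and interior points of edges). Direct product: $G_1\times G_2$ has vertex set $V(G_1)\times V(G_2)$, and $(u_1,v_1)$, $(u_2,v_2)$ are adjacent iff $[u_1,u_2]\in E(G_1)$ and $[v_1,v_2]\in E(G_2)$. Hyperbolicity constant: in a geodesic metric space $X$, a geodesic triangle is the union of three geodesics $[x_1x_2],[x_2x_3],[x_3x_1]$; it is $\delta$-thin if each side is contained in the $\delta$-neighborhood of the union of the other two sides. $\delta(T)$ is the infimum of $\delta\ge 0$ such that $T$ is $\delta$-thin, and $\delta(X):=\sup_T\delta(T)$ over all geodesic triangles $T$ in $X$. *)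

(* Defs.v *)
From mathcomp Require Import all_boot all_order all_algebra.
From mathcomp Require Import boolp classical_sets reals ereal.

Set Implicit Arguments.
Unset Strict Implicit.
Unset Printing Implicit Defensive.

Import Order.TTheory GRing.Theory Num.Theory.

Local Open Scope classical_set_scope.
Local Open Scope ring_scope.

(** * Graphs: a graph on a finite type is given by its adjacency relation *)

(* [ordS i] is [i + 1] modulo [m]; this is the usual simple cycle once
   [3 <= m]. *)
Definition cycle_graph (m : nat) : rel 'I_m :=
  fun i j => (j == ordS i) || (i == ordS j).

Definition path_graph (n : nat) : rel 'I_n :=
  fun i j => (j == i.+1 :> nat) || (i == j.+1 :> nat).

Definition direct_product (V1 V2 : finType) (e1 : rel V1) (e2 : rel V2) :
    rel (V1 * V2) :=
  fun x y => e1 x.1 y.1 && e2 x.2 y.2.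

(** * The metric space associated with a graph *)

Section MetricGraph.
Variables (R : realType) (V : finType) (e : rel V).

(* The function [p : V -> R] vanishes off [{u, v}], where [u, v] are adjacent
   or equal. *)
Definition carried_by (p : {ffun V -> R}) (u v : V) : bool :=
  ((u == v) || e u v) &&
  [forall w, (p w != 0) ==> ((w == u) || (w == v))].

(* Points are given by barycentric coordinates: the point at distance [t] from
   [u] on the edge [uv] has coordinates [1 - t] at [u], [t] at [v] and [0]
   elsewhere; thus a vertex is the same point on all the edges containing it. *)
Definition is_graph_point (p : {ffun V -> R}) : bool :=
  [&& [forall w, 0 <= p w], \sum_w p w == 1 &
      [exists u, [exists v, carried_by p u v]]].

Definition graph_point := {p : {ffun V -> R} | is_graph_point p}.

Definition same_edge (p q : graph_point) : bool :=
  [exists u, [exists v, carried_by (val p) u v && carried_by (val q) u v]].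

(* For two points of one edge [uv] with parameters [s] and [t], the coordinates
   differ by [|s - t|] both at [u] and at [v], so this is [|s - t|]. *)
Definition segment_length (p q : graph_point) : R :=
  (\sum_w `|val p w - val q w|) / 2.

Fixpoint chain_length (p : graph_point) (s : seq graph_point) : R :=
  if s is q :: s' then segment_length p q + chain_length q s' else 0.

(* The shortest-path distance, as the infimum of the lengths of the piecewise
   linear paths from [p] to [q]. It is meaningful for connected graphs only:
   [inf] of the empty set is [0]. *)
Definition graph_dist (p q : graph_point) : R :=
  inf [set l | exists s : seq graph_point,
    [/\ path same_edge p s, last p s = q & l = chain_length p s]].

End MetricGraph.

(** * Hyperbolicity constant of a space [X] with distance [d] *)

Section Hyperbolicity.
Variables (R : realType) (X : Type) (d : X -> X -> R).

Definition is_geodesic (x y : X) (S : set X) : Prop :=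
  exists (L : R) (g : R -> X),
    [/\ 0 <= L, g 0 = x, g L = y,
        (forall s t, 0 <= s <= L -> 0 <= t <= L -> d (g s) (g t) = `|s - t|)
      & S = [set g t | t in [set t | 0 <= t <= L]]].

Definition in_neighborhood (r : R) (A B : set X) : Prop :=
  forall p, A p -> exists2 q, B q & d p q <= r.

Definition thin (r : R) (A B C : set X) : Prop :=
  [/\ in_neighborhood r A (B `|` C),
      in_neighborhood r B (C `|` A)
    & in_neighborhood r C (A `|` B)].

Definition triangle_constant (A B C : set X) : \bar R :=
  ereal_inf [set r%:E | r in [set r : R | 0 <= r /\ thin r A B C]].

Definition hyperbolicity_constant : \bar R :=
  ereal_sup [set a | exists x1 x2 x3 : X, exists A B C : set X,
    [/\ is_geodesic x1 x2 A, is_geodesic x2 x3 B, is_geodesic x3 x1 C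
      & a = triangle_constant A B C]].

End Hyperbolicity.

(* Main.v *)
Require Import Defs.
From mathcomp Require Import all_boot all_order all_algebra.
From mathcomp Require Import boolp classical_sets reals ereal.
From mathcomp Require Import topology normedtype.
From mathcomp Require Import zify ring lra.

(** Since [m] is odd, [Z/m * Z/2 = Z/2m], so the product graph is the subgraph
    of [C_2m * P_n] (with [N = n - 1] the highest level) formed by the vertices
    [(k, j)] with [k = j] modulo 2, where the distance is
    [max(d_C2m(k, k'), |j - j'|)].  All three values are [K / 2] for
    [K = max(m, min(N, 2m - 1))].

    Upper bound: as the graph is bipartite, the diameter including interior
    points of edges is still [max(m, N)], so a side of length at most [K] lies
    within [K / 2] of its ends.  A longer side exists only if [N >= 2m]; it then
    moves monotonically through the levels.  A vertex [w] within [1/2] of a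
    point [p] of that side has a level crossed by one of the other two sides,
    at a vertex; by parity two vertices of one level are at distance at most
    [m - 1], so [p] is within [m - 1/2].

    Lower bound: going around the cylinder both ways from position [0] to
    position [K], in [K] steps each, gives a geodesic bigon; the middle of the
    direct way is at distance at least [K / 2] from the other way. *)

Set Implicit Arguments.
Unset Strict Implicit.
Unset Printing Implicit Defensive.

Import Order.TTheory GRing.Theory Num.Theory.

Local Open Scope classical_set_scope.
Local Open Scope ring_scope.

(** * Intermediate values of Lipschitz functions on an interval *)

Section Lipschitz.
Import numFieldNormedType.Exports.

(** [f] is controlled on [0, L] only. Composing it with the retraction [clamp] of the line onto
    [0, L] gives a function continuous everywhere. *)
Lemma lipschitz_IVT (R : realType) (f : R -> R) (L c : R) : 0 <= L ->
  (forall s t, 0 <= s <= L -> 0 <= t <= L -> `|f s - f t| <= `|s - t|) ->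
  Num.min (f 0) (f L) <= c <= Num.max (f 0) (f L) ->
  exists2 t, 0 <= t <= L & f t = c.
Proof.
move=> L0 fL fc.
pose clamp (t : R) := Num.max 0 (Num.min t L).
have clampE t : 0 <= t <= L -> clamp t = t.
  by case/andP=> t0 tL; rewrite /clamp (min_idPl tL) (max_idPr t0).
have clamp_range t : 0 <= clamp t <= L.
  by rewrite /clamp le_max lexx ge_max L0 ge_min lexx orbT.
have clamp_lip s t : `|clamp s - clamp t| <= `|s - t|.
  rewrite ler_norml /clamp.
  have := ler_norm (s - t); have := ler_norm (t - s); rewrite (distrC t s).
  by case: (leP s L) => ?; case: (leP t L) => ?; 
    case: (leP 0 s) => ?; case: (leP 0 t) => ?; rewrite ?(max_idPr L0) //; lra.
have [||t] := @IVT R (f \o clamp) 0 L c L0; last 1 first.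
- by rewrite in_itv /= => t0L <-; exists t; rewrite ?clampE.
- apply: continuous_subspaceT => x; apply/cvgrPdist_lt => eps eps0.
  apply: filterS (nbhsx_ballx x eps eps0) => y.
  apply: le_lt_trans; apply: le_trans (clamp_lip _ _).
  exact: fL.
- by rewrite /= !clampE ?lexx ?L0.
Qed.

End Lipschitz.

(** * Chains, parametrized edges and Lipschitz functions on a metric graph *)

Section MetricGraph.
Variables (R : realType) (V : finType) (e : rel V).
Implicit Types (p q : graph_point R e) (u v : V).

Lemma same_edgeC p q : same_edge p q = same_edge q p.
Proof.
by rewrite /same_edge; apply: eq_existsb => u; apply: eq_existsb => v;
  rewrite andbC.
Qed.

Lemma segment_lengthC p q : segment_length p q = segment_length q p.
Proof.
by rewrite /segment_length; congr (_ / 2); apply: eq_bigr => w _; rewrite distrC.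
Qed.

Lemma segment_length_ge0 p q : 0 <= segment_length p q.
Proof. by rewrite divr_ge0 ?sumr_ge0. Qed.

Lemma chain_length_ge0 p s : 0 <= chain_length p s.
Proof.
by elim: s p => //= q s IHs p; rewrite addr_ge0 ?segment_length_ge0.
Qed.

(** Stronger than a bound on [graph_dist]: it provides an actual chain, whereas the infimum is also
    0 when there is none. *)
Definition joined p q (r : R) :=
  exists s, [/\ path (@same_edge R V e) p s, last p s = q & chain_length p s <= r].

Lemma joined_refl p r : 0 <= r -> joined p p r.
Proof. by move=> r0; exists [::]. Qed.

Lemma joined_edge p q : same_edge p q -> joined p q (segment_length p q).
Proof. by move=> pq; exists [:: q]; rewrite /= pq addr0. Qed.

Lemma joinedW p q r r' : r <= r' -> joined p q r -> joined p q r'.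
Proof.
by move=> rr' [s [ps sq sr]]; exists s; split=> //; apply: le_trans rr'.
Qed.

Lemma joined_trans q p p' r r' :
  joined p q r -> joined q p' r' -> joined p p' (r + r').
Proof.
move=> [s [ps sq sr]] [s' [ps' sq' sr']]; exists (s ++ s').
rewrite cat_path last_cat ps sq ps' sq'; split=> //.
have -> : chain_length p (s ++ s') = chain_length p s + chain_length q s'.
  rewrite -{}sq; elim: s p {ps sr ps' sq' sr'} => [|a s IHs] p /=;
    by rewrite ?add0r // IHs addrA.
exact: lerD.
Qed.

Lemma joined_sym p q r : joined p q r -> joined q p r.
Proof.
move=> [s [ps sq sr]]; apply: joinedW sr _; rewrite -{}sq.
elim: s p ps => [|a s IHs] p /=; first by move=> _; apply: joined_refl.
case/andP=> pa /IHs as_; rewrite addrC; apply: joined_trans as_ _.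
by rewrite segment_lengthC; apply: joined_edge; rewrite same_edgeC.
Qed.

Lemma graph_dist_le p q r : joined p q r -> graph_dist p q <= r.
Proof.
move=> [s [ps sq sr]]; apply: le_trans sr; apply: ge_inf; last by exists s.
by exists 0 => _ [t [_ _ ->]]; apply: chain_length_ge0.
Qed.

Definition edgewise_lipschitz (F : graph_point R e -> R) :=
  forall p q, same_edge p q -> `|F p - F q| <= segment_length p q.

(** Source of all lower bounds on distances: the increments of [F] add up along any chain. The
    hypothesis [joined p q r], for any [r], makes the set under the infimum nonempty. *)
Lemma lipschitz_dist F p q r : edgewise_lipschitz F ->
  joined p q r -> `|F p - F q| <= graph_dist p q.
Proof.
move=> FL [s [ps sq sr]]; apply: lb_le_inf; first by exists (chain_length p s), s.
move=> _ [t [pt tq ->]]; rewrite -{}tq {q s ps sq sr}.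
elim: t p pt => [|a t IHt] p /=; first by rewrite subrr normr0.
case/andP=> pa /IHt at_; apply: le_trans (ler_distD (F a) _ _) _.
exact: lerD (FL _ _ pa) at_.
Qed.

Lemma graph_dist_refl p : graph_dist p p = 0.
Proof.
apply/eqP; rewrite eq_le (graph_dist_le (joined_refl p (lexx 0))) /=.
apply: lb_le_inf; first by exists 0, [::].
by move=> _ [t [_ _ ->]]; apply: chain_length_ge0.
Qed.

Definition edge_coords u v (t : R) : {ffun V -> R} :=
  [ffun w => (1 - t) * (w == u)%:R + t * (w == v)%:R].

Lemma sum_edge_coords u v t (f : V -> R) :
  \sum_w edge_coords u v t w * f w = (1 - t) * f u + t * f v.
Proof.
have sum_delta a : \sum_w (w == a)%:R * f w = f a.
  rewrite (bigD1 a) //= eqxx mul1r big1 ?addr0 // => w /negPf->.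
  by rewrite mul0r.
under eq_bigr => w _ do rewrite ffunE mulrDl -!mulrA.
by rewrite big_split /= -!mulr_sumr !sum_delta.
Qed.

Lemma edge_coords_is_point u v t : (u == v) || e u v -> 0 <= t <= 1 ->
  is_graph_point e (edge_coords u v t).
Proof.
move=> uv t01; apply/and3P; split.
- by apply/forallP=> w; rewrite ffunE; do 2 case: eqP => _ /=; lra.
- have := sum_edge_coords u v t (fun=> 1).
  by under eq_bigr do rewrite mulr1; move=> ->; apply/eqP; ring.
- apply/existsP; exists u; apply/existsP; exists v; rewrite /carried_by uv.
  apply/forallP=> w; rewrite ffunE.
  by case: (w == u); case: (w == v); rewrite ?implybT //= !mulr0 addr0 eqxx.
Qed.

Lemma vertex_is_point u : is_graph_point e (edge_coords u u 0).
Proof. by apply: edge_coords_is_point; rewrite ?eqxx ?lexx ?ler01. Qed.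

Definition vertex_point u : graph_point R e :=
  exist (fun p : {ffun V -> R} => is_graph_point e p) _ (vertex_is_point u).

(** Total through [insubd]: if [u], [v] and [t] do not describe a point of an edge, the value is the
    vertex [u]. *)
Definition edge_point u v t : graph_point R e :=
  insubd (vertex_point u) (edge_coords u v t).

Lemma val_edge_point u v t : (u == v) || e u v -> 0 <= t <= 1 ->
  val (edge_point u v t) = edge_coords u v t.
Proof. by move=> uv t01; rewrite val_insubd edge_coords_is_point. Qed.

Lemma edge_point0 u v : edge_point u v 0 = vertex_point u.
Proof.
apply: val_inj; rewrite val_insubd /=.
suff -> : edge_coords u v 0 = edge_coords u u 0 by rewrite if_same.
by apply/ffunP=> w; rewrite !ffunE !mul0r.
Qed.

Lemma edge_point1 u v : e u v -> edge_point u v 1 = vertex_point v.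
Proof.
move=> uv; apply: val_inj; rewrite val_edge_point ?uv ?orbT ?lexx ?ler01 //.
by apply/ffunP=> w; rewrite !ffunE /=; lra.
Qed.

(** The coordinates vanish off [u] and [v] and sum to 1, so [t] is the coordinate at [v]; in the
    degenerate case [u = v], [t] is 0. *)
Lemma carried_edge_point p u v : carried_by e (val p) u v ->
  exists2 t, 0 <= t <= 1 & p = edge_point u v t.
Proof.
case/andP=> uv /forallP psupp.
have /and3P[/forallP p0 /eqP p1 _] := valP p.
have pw w : w != u -> w != v -> val p w = 0.
  move=> wu wv; apply/eqP; have := psupp w.
  by rewrite (negPf wu) (negPf wv) implybF negbK.
case: (eqVneq u v) uv psupp pw => [<- _ _ pw|uv euv _ pw].
  exists 0; rewrite ?lexx ?ler01 // edge_point0; apply: val_inj.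
  apply/ffunP=> w; rewrite ffunE mul0r addr0 subr0 mul1r.
  have [->|wu] := eqVneq w u; last exact: pw.
  by rewrite -p1 (bigD1 u) //= big1 ?addr0 // => a au; apply: pw.
have puv : val p u + val p v = 1.
  rewrite -p1 (bigD1 u) //= (bigD1 v) 1?eq_sym //= big1 ?addr0 //.
  by move=> a /andP[]; apply: pw.
have := p0 u; have := p0 v => pv0 pu0.
exists (val p v); first by lra.
apply: val_inj; rewrite val_edge_point ?(negPf uv) //; last by lra.
apply/ffunP=> w; rewrite ffunE.
have [->|wu] := eqVneq w u; first by rewrite (negPf uv) /=; lra.
have [->|wv] := eqVneq w v; first by rewrite /=; lra.
by rewrite pw //= !mulr0 addr0.
Qed.

Lemma carried_edge_pointE u v t : e u v -> 0 <= t <= 1 ->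
  carried_by e (val (edge_point u v t)) u v.
Proof.
move=> uv t01; rewrite val_edge_point ?uv ?orbT // /carried_by uv orbT.
apply/forallP=> w; rewrite ffunE.
by case: (w == u); case: (w == v); rewrite ?implybT //= !mulr0 addr0 eqxx.
Qed.

Lemma segment_edge_point u v s t : u != v -> e u v -> 0 <= s <= 1 ->
  0 <= t <= 1 -> segment_length (edge_point u v s) (edge_point u v t) = `|s - t|.
Proof.
move=> uv euv s01 t01; rewrite /segment_length.
rewrite !val_edge_point ?euv ?orbT // (bigD1 u) //= (bigD1 v) 1?eq_sym //=.
rewrite big1 => [|w /andP[/negPf wu /negPf wv]]; last first.
  by rewrite !ffunE wu wv !mulr0 subrr normr0.
rewrite !ffunE !eqxx (negPf uv) eq_sym (negPf uv) /= !mulr0 !mulr1 !addr0 !add0r.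
have -> : 1 - s - (1 - t) = - (s - t) by ring.
by rewrite normrN; lra.
Qed.

Lemma same_edge_edge_point u v s t : e u v -> 0 <= s <= 1 ->
  0 <= t <= 1 -> same_edge (edge_point u v s) (edge_point u v t).
Proof.
move=> uv s01 t01; apply/existsP; exists u; apply/existsP; exists v.
by rewrite !carried_edge_pointE.
Qed.

Lemma joined_edge_point u v s t : u != v -> e u v -> 0 <= s <= 1 ->
  0 <= t <= 1 -> joined (edge_point u v s) (edge_point u v t) `|s - t|.
Proof.
move=> uv euv s01 t01; rewrite -(segment_edge_point uv euv) //.
by apply: joined_edge; apply: same_edge_edge_point.
Qed.

Lemma edge_pointC u v t : symmetric e -> e u v -> 0 <= t <= 1 ->
  edge_point u v t = edge_point v u (1 - t).
Proof.
move=> e_sym uv t01; apply: val_inj.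
rewrite !val_edge_point ?uv ?orbT // ?(e_sym v) ?uv ?orbT //; last by lra.
by apply/ffunP=> w; rewrite !ffunE; ring.
Qed.

Lemma joined_edge_left u v t : u != v -> e u v -> 0 <= t <= 1 ->
  joined (edge_point u v t) (vertex_point u) t.
Proof.
move=> uv euv t01; rewrite -(edge_point0 u v).
have := joined_edge_point uv euv t01 (_ : 0 <= 0 <= 1).
by rewrite subr0 ger0_norm ?(andP t01).1 //; apply; rewrite lexx ler01.
Qed.

Lemma joined_edge_right u v t : u != v -> e u v -> 0 <= t <= 1 ->
  joined (edge_point u v t) (vertex_point v) (1 - t).
Proof.
move=> uv euv t01; rewrite -(edge_point1 euv).
have := joined_edge_point uv euv t01 (_ : 0 <= 1 <= 1).
by rewrite distrC ger0_norm ?subr_ge0 ?(andP t01).2 //; apply; rewrite lexx ler01.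
Qed.

Lemma edgewise_lipschitzP (F : graph_point R e -> R) : irreflexive e ->
  (forall u v s t, e u v -> 0 <= s <= 1 -> 0 <= t <= 1 ->
    `|F (edge_point u v s) - F (edge_point u v t)| <= `|s - t|) ->
  edgewise_lipschitz F.
Proof.
move=> e_irr FL p q /existsP[u /existsP[v /andP[pc qc]]].
have /andP[uv _] := pc.
have [s s01 ->] := carried_edge_point pc; have [t t01 ->] := carried_edge_point qc.
case: (eqVneq u v) uv => [<- _|uv /= euv]; last first.
  by rewrite segment_edge_point ?FL.
suff -> : edge_point u u s = edge_point u u t.
  by rewrite subrr normr0 segment_length_ge0.
apply: val_inj; rewrite !val_edge_point ?eqxx //.
by apply/ffunP=> w; rewrite !ffunE; lra.
Qed.

Definition interpolate (f : V -> R) p : R := \sum_w val p w * f w.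

Lemma interpolate_edge_point f u v t : e u v -> 0 <= t <= 1 ->
  interpolate f (edge_point u v t) = (1 - t) * f u + t * f v.
Proof.
by move=> uv t01; rewrite /interpolate val_edge_point ?uv ?orbT ?sum_edge_coords.
Qed.

Lemma interpolate_lipschitz f : irreflexive e ->
  (forall u v, e u v -> `|f u - f v| <= 1) -> edgewise_lipschitz (interpolate f).
Proof.
move=> e_irr fL; apply: edgewise_lipschitzP => // u v s t uv s01 t01.
rewrite !interpolate_edge_point //.
have -> : (1 - s) * f u + s * f v - ((1 - t) * f u + t * f v) =
          - ((s - t) * (f u - f v)) by ring.
by rewrite normrN normrM ler_piMr ?fL.
Qed.

(** Unit-speed parametrization of the walk [w], meant for [t] in [0, k]. At a positive integer time
    the point is the end of the earlier edge. *)
Fixpoint walk_point (w : nat -> V) k (t : R) : graph_point R e :=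
  if k is k'.+1 then
    if t <= k'%:R then walk_point w k' t
    else edge_point (w k') (w k) (t - k'%:R)
  else vertex_point (w 0%N).

Lemma walk_point0 w k : walk_point w k 0 = vertex_point (w 0%N).
Proof. by elim: k => //= k ->; rewrite ler0n. Qed.

Lemma walk_point_ex w k t : (0 < k)%N -> 0 <= t <= k%:R ->
  exists i s, [/\ (i < k)%N, 0 <= s <= 1, t = i%:R + s &
    walk_point w k t = edge_point (w i) (w i.+1) s].
Proof.
case: k => // k _; elim: k t => [|k IHk] t /andP[t0 tk] /=.
  exists 0%N, t; rewrite t0 tk add0r; split=> //.
  have [t_le0|_] := leP; last by rewrite subr0.
  by have -> : t = 0 by [lra]; rewrite edge_point0.
have [tk'|tk'] := leP.
  have [|i [s [ik s01 tE gE]]] := IHk t; first by rewrite t0.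
  by exists i, s; split; rewrite // ltnW.
exists k.+1, (t - k.+1%:R); split=> //; last by rewrite addrC subrK.
by rewrite -natr1 in tk; lra.
Qed.

(** * Walks that are geodesics *)

Section Walk.
Variables (w : nat -> V) (k : nat).
Hypotheses (e_irr : irreflexive e) (walk : forall i, (i < k)%N -> e (w i) (w i.+1)).

Lemma edge_neq u v : e u v -> u != v.
Proof. by move=> uv; apply/eqP=> uv'; rewrite uv' e_irr in uv. Qed.

Lemma walk_point_end i : (i <= k)%N -> walk_point w i i%:R = vertex_point (w i).
Proof.
case: i => //= i ik; rewrite ler_nat ltnn -natr1 addrC addKr edge_point1 //.
exact: walk.
Qed.

Lemma joined_walk_point i s t : (i <= k)%N -> 0 <= s -> s <= t -> t <= i%:R ->
  joined (walk_point w i s) (walk_point w i t) (t - s).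
Proof.
elim: i s t => [|i IHi] s t ik s0 st ti /=.
  by apply: joined_refl; rewrite subr_ge0.
have ei := walk ik; have nei := edge_neq ei; rewrite -natr1 in ti.
have [ti'|ti'] := leP t.
  by rewrite (le_trans st ti'); apply: IHi (ltnW ik) s0 st ti'.
have last_edge a : i%:R <= a -> a <= t ->
    joined (edge_point (w i) (w i.+1) (a - i%:R))
           (edge_point (w i) (w i.+1) (t - i%:R)) (t - a).
  move=> ia at_; apply: joinedW (joined_edge_point _ _ _ _) => //; try lra.
  by rewrite ler_norml; lra.
have [si|si] := leP s; last by apply: last_edge; lra.
(* The piece contains the vertex [w i] in its interior or as its start: the chain is broken
   there. *)
have -> : t - s = (i%:R - s) + (t - i%:R) by ring.
apply: (joined_trans (IHi _ _ (ltnW ik) s0 si (lexx _))).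
rewrite walk_point_end ?(ltnW ik) // -(edge_point0 _ (w i.+1)).
by have := last_edge i%:R (lexx _) (ltW ti'); rewrite subrr.
Qed.

Lemma interpolate_walk_point f c t : (0 < k)%N -> 0 <= t <= k%:R ->
  (forall i, (i <= k)%N -> f (w i) = c + i%:R) ->
  interpolate f (walk_point w k t) = c + t.
Proof.
move=> k0 tk fw; have [i [s [ik s01 -> ->]]] := walk_point_ex w k0 tk.
rewrite interpolate_edge_point ?walk // !fw ?(ltnW ik) //.
by rewrite -natr1; ring.
Qed.

(** The function [f] is a certificate: the walk itself bounds distances from above, and the
    interpolation of [f], which is 1-Lipschitz and grows at unit speed along the walk, bounds them
    from below. *)
Lemma walk_geodesic (f : V -> R) c : (forall u v, e u v -> `|f u - f v| <= 1) ->
  (0 < k)%N -> (forall i, (i <= k)%N -> f (w i) = c + i%:R) ->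
  is_geodesic (@graph_dist R V e) (vertex_point (w 0%N)) (vertex_point (w k))
    [set walk_point w k t | t in [set t : R | 0 <= t <= k%:R]].
Proof.
move=> fL k0 fw; exists k%:R, (walk_point w k); split=> //.
- exact: walk_point0.
- exact: walk_point_end.
move=> s t /andP[s0 sk] /andP[t0 tk].
have st : joined (walk_point w k s) (walk_point w k t) `|s - t|.
  have [st|/ltW ts] := leP s t.
    by rewrite ler0_norm ?subr_le0 // opprB; apply: joined_walk_point.
  by rewrite ger0_norm ?subr_ge0 //; apply/joined_sym/joined_walk_point.
apply/eqP; rewrite eq_le graph_dist_le //=.
have := lipschitz_dist (interpolate_lipschitz e_irr fL) st.
rewrite !(interpolate_walk_point (c := c)) ?s0 ?t0 //.
by have -> : c + s - (c + t) = s - t by ring.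
Qed.
End Walk.

End MetricGraph.

(** * The product graph and its positions in Z/2m *)

Section CylinderGraph.
Variables (m' n : nat).
Local Notation m := m'.+1.
Local Notation V := ('I_m * 'I_n.+1)%type.
Local Notation e := (direct_product (@cycle_graph m) (@path_graph n.+1)).
Implicit Types u v : V.

(** Reducing [a] modulo [m] lets walks around the cycle be written in unwrapped coordinates; [b] is
    meant to be at most [n]. *)
Definition vertex_at (a b : nat) : V := (inord (a %% m), inord b).

(* The element of [Z/2m] that is [u.1] modulo [m] and [u.2] modulo 2. *)
Definition position (u : V) : nat := if odd (u.1 + u.2) then (u.1 + m)%N else u.1.

Lemma product_sym : symmetric e.
Proof.
by move=> u v; rewrite /direct_product /cycle_graph /path_graph orbC
  [X in _ && X]orbC.
Qed.

Lemma product_irr : irreflexive e.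
Proof. by move=> u; apply/negP => /andP[_]; rewrite /path_graph; lia. Qed.

Lemma vertex_at_edge a b b' : (b <= n)%N -> (b' <= n)%N ->
  b' = b.+1 \/ b = b'.+1 -> e (vertex_at a b) (vertex_at a.+1 b').
Proof.
move=> bn b'n bb'; apply/andP; split; last first.
  by rewrite /path_graph /= !inordK //; apply/orP; case: bb' => ->;
    [left|right].
apply/orP; left; rewrite -val_eqE /= !inordK ?ltn_pmod //.
by rewrite -addn1 -[in X in _ == X]addn1 modnDml.
Qed.

Lemma edge_level u v : e u v -> v.2 = u.2.+1 :> nat \/ u.2 = v.2.+1 :> nat.
Proof. by case/andP=> _ /orP[]/eqP; [left|right]. Qed.

(** An edge changes [u.1] by 1 modulo [m] and flips the parity of the level, so it changes the
    position by 1 modulo 2m. The last two cases are the wrap between 2m - 1 and 0. *)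
Lemma edge_position u v : odd m -> e u v ->
  [\/ position v = (position u).+1, position u = (position v).+1,
      position u = 0%N /\ position v = (2 * m).-1 |
      position v = 0%N /\ position u = (2 * m).-1].
Proof.
wlog vu : u v / v.1 == ordS u.1.
  move=> wlg m_odd uv; have /andP[/orP[vu|uv1] _] := uv; first exact: wlg.
  have vu : e v u by rewrite product_sym.
  by case: (wlg _ _ uv1 m_odd vu) => ?;
    [constructor 2|constructor 1|constructor 4|constructor 3].
move=> m_odd /edge_level ul.
have {}vu : v.1 = (u.1.+1 %% m)%N :> nat by rewrite (eqP vu).
have u1m := ltn_ord u.1; rewrite /position.
(* At the seam [u.1] is m - 1, which is even, and [v.1] is 0: the parity of the level decides
   between the passage from m - 1 to m and the wrap. *)
have [um|um] := eqVneq u.1.+1 m.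
  move: vu; rewrite um modnn => vu.
  have u_odd : odd u.1 = false.
    by move/(congr1 odd): (um); rewrite m_odd /=; case: odd.
  rewrite !oddD vu u_odd /=; case: ul => ->; rewrite /=.
    by case: (odd u.2) => /=; [constructor 4|constructor 1]; lia.
  by case: (odd v.2) => /=; [constructor 1|constructor 4]; lia.
have {}um : (u.1.+1 < m)%N by rewrite ltn_neqAle um.
rewrite vu modn_small //; constructor 1.
rewrite !oddD; case: ul => -> /=; case: (odd u.1).
- by case: (odd u.2) => /=; lia.
- by case: (odd u.2) => /=; lia.
- by case: (odd v.2) => /=; lia.
- by case: (odd v.2) => /=; lia.
Qed.

Lemma position_vertex_at a b : (a < 2 * m)%N -> (b <= n)%N -> odd m ->
  odd a = odd b -> position (vertex_at a b) = a.
Proof.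
move=> am bn m_odd ab; rewrite /position /= !inordK ?ltn_pmod //.
have [am'|ma] := ltnP a m; first by rewrite modn_small // oddD ab addbb.
have -> : a = (a - m + m)%N by lia.
rewrite modnDr modn_small; last by lia.
by rewrite oddD oddB // m_odd ab; case: (odd b).
Qed.

Lemma vertex_at_surj u : u = vertex_at u.1 u.2.
Proof.
by case: u => i j; rewrite /vertex_at /= modn_small // !inord_val.
Qed.

Lemma vertex_atD a b : vertex_at (a + m) b = vertex_at a b.
Proof. by rewrite /vertex_at modnDr. Qed.

(** * Distances in the product graph *)

Section Distance.
Variable R : realType.
Local Notation vp := (@vertex_point R V e).
Hypothesis n_gt0 : (0 < n)%N.

Lemma joined_edge_vertices u v : e u v -> joined (vp u) (vp v) 1.
Proof.
move=> uv; have := joined_edge_point (R := R) (edge_neq product_irr uv) uv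
  (s := 0) (t := 1).
rewrite edge_point0 edge_point1 // sub0r normrN normr1.
by apply; rewrite lexx ler01.
Qed.

(** Every step changes both coordinates by 1. The parity conditions make the surplus of steps even
    in each coordinate, so it can be spent going back and forth. *)
Lemma joined_vertex_at M a b a' b' : (b <= n)%N -> (b' <= n)%N ->
  odd (a + a') = odd M -> odd (b + b') = odd M ->
  (a <= a' + M)%N -> (a' <= a + M)%N -> (b <= b' + M)%N -> (b' <= b + M)%N ->
  joined (vp (vertex_at a b)) (vp (vertex_at a' b')) M%:R.
Proof.
elim: M a b => [|M IHM] a b bn b'n aM bM a1 a2 b1 b2.
  have -> : a = a' by lia.
  by have -> : b = b' by [lia]; apply: joined_refl.
(* The next level: towards [b'], or, if already there, any neighbouring level; the number [M] of
   steps left is then odd, hence positive. *)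
have [b3 [b3n b3b b31 b32]] : exists b3, [/\ (b3 <= n)%N,
    b3 = b.+1 \/ b = b3.+1, (b3 <= b' + M)%N & (b' <= b3 + M)%N].
  have [bb'|b'b|bb'] := ltngtP b b'.
  - by exists b.+1; split; lia.
  - by exists b.-1; split; lia.
  - have M1 : odd M by move: bM; rewrite bb' addnn odd_double /=; case: odd.
    by case: (posnP b) => b0; [exists b.+1|exists b.-1]; split; lia.
rewrite -natr1 addrC.
have oddS x y : odd (x + y) = odd M.+1 -> odd (x.+1 + y) = odd M.
  by rewrite addSn /= => ->; rewrite negbK.
have oddP x y : odd (x.+1 + y) = odd M.+1 -> odd (x + y) = odd M.
  by rewrite addSn /=; move/negb_inj.
have b3M : odd (b3 + b') = odd M.
  by case: b3b => b3E; [rewrite b3E; apply: oddS|apply: oddP; rewrite -b3E].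
have [aa'|a'a] := leqP a a'.
  apply: (@joined_trans _ _ _ (vp (vertex_at a.+1 b3))).
    by apply: joined_edge_vertices; apply: vertex_at_edge.
  by apply: IHM => //; [exact: oddS|lia|lia].
case: a a'a aM a1 a2 => // a a'a aM a1 a2.
apply: (@joined_trans _ _ _ (vp (vertex_at a b3))).
  apply: joined_edge_vertices; rewrite product_sym; apply: vertex_at_edge => //.
  by case: b3b; [right|left].
by apply: IHM => //; [exact: oddP|lia|lia].
Qed.

(** The two ways around the odd cycle, of lengths d and m - d, have opposite parities, so one has
    the parity of [M]. It has length at most m - 1, unless it is m - d with d = 0; then [M] is odd
    and at least m - 1, which is even, hence at least m. *)
Lemma joined_vertices u v M : odd m -> (m' <= M)%N -> odd (u.2 + v.2) = odd M ->
  (u.2 <= v.2 + M)%N -> (v.2 <= u.2 + M)%N -> joined (vp u) (vp v) M%:R.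
Proof.
move=> m_odd mM uvM uv vu; rewrite (vertex_at_surj u) (vertex_at_surj v).
have u1 := ltn_ord u.1; have v1 := ltn_ord v.1.
have u2 := ltn_ord u.2; have v2 := ltn_ord v.2.
have [uv1M|uv1M] := eqVneq (odd (u.1 + v.1)) (odd M).
  by apply: joined_vertex_at => //; lia.
have [uv1|vu1] := leqP u.1 v.1.
  rewrite -vertex_atD; apply: joined_vertex_at => //; lia.
rewrite -(vertex_atD v.1); apply: joined_vertex_at => //; lia.
Qed.

Definition level : graph_point R e -> R := interpolate (fun u => u.2%:R).

Lemma level_edge_lip u v : e u v -> `|u.2%:R - v.2%:R : R| <= 1.
Proof.
by case/edge_level => ->; rewrite -natr1 ler_norml; lra.
Qed.

Lemma level_lip : edgewise_lipschitz level.
Proof. exact: interpolate_lipschitz product_irr level_edge_lip. Qed.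

Lemma point_on_edge (p : graph_point R e) : exists u v t,
  [/\ e u v, v.2 = u.2.+1 :> nat, 0 <= t <= 1, p = edge_point e u v t &
      level p = u.2%:R + t].
Proof.
suff [u [v [t [uv vu t01 ->]]]] : exists u v t,
    [/\ e u v, v.2 = u.2.+1 :> nat, 0 <= t <= 1 & p = edge_point e u v t].
  exists u, v, t; split=> //.
  by rewrite /level interpolate_edge_point // vu -natr1; ring.
have /and3P[_ _ /existsP[u /existsP[v pc]]] := valP p.
have [/orP uv _] := andP pc; have [t t01 ->] := carried_edge_point pc.
(* A vertex is the start of an upward edge ([t] is 0), except at the top level, where it is the end
   of one ([t] is 1). *)
case: uv => [/eqP<-|uv].
  have -> : edge_point e u u t = vp u.
    apply: val_inj; rewrite val_edge_point ?eqxx //.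
    by apply/ffunP => w; rewrite !ffunE; ring.
  have un : (u.2 <= n)%N by rewrite -ltnS.
  have [un'|nu] := ltnP u.2 n.
    have uv : e u (vertex_at u.1.+1 u.2.+1).
      by rewrite {1}(vertex_at_surj u); apply: vertex_at_edge => //; left.
    exists u, (vertex_at u.1.+1 u.2.+1), 0.
    by rewrite edge_point0 lexx ler01; split=> //; rewrite /= inordK.
  have u2 : u.2 = u.2.-1.+1 :> nat by lia.
  have uv : e (vertex_at u.1.+1 u.2.-1) u.
    rewrite product_sym {1}(vertex_at_surj u).
    by apply: vertex_at_edge; [|lia|right].
  exists (vertex_at u.1.+1 u.2.-1), u, 1.
  rewrite edge_point1 // lexx ler01; split=> //.
  by rewrite /= inordK; [exact: u2|rewrite ltnS (leq_trans (leq_pred _))].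
case: (edge_level uv) => uv2; first by exists u, v, t.
exists v, u, (1 - t); rewrite product_sym; split=> //; first by lra.
exact: edge_pointC product_sym _ _.
Qed.

Lemma edge_flip u v (t : R) : e u v -> 0 <= t <= 1 ->
  [/\ e v u, 0 <= 1 - t <= 1 & edge_point e u v t = edge_point e v u (1 - t)].
Proof.
move=> uv t01; rewrite product_sym; split=> //; first by lra.
exact: edge_pointC product_sym _ _.
Qed.

Lemma joined_through_edges u u' v v' (s t r : R) :
  e u u' -> e v v' -> 0 <= s <= 1 -> 0 <= t <= 1 -> joined (vp u) (vp v) r ->
  joined (edge_point e u u' s) (edge_point e v v' t) (s + r + t).
Proof.
move=> uu' vv' s01 t01 uv.
have [nuu' nvv'] := (edge_neq product_irr uu', edge_neq product_irr vv').
apply: joined_trans (joined_sym (joined_edge_left nvv' vv' t01)).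
exact: joined_trans (joined_edge_left nuu' uu' s01) uv.
Qed.

(* The two joins through opposite pairs of ends have total length the sum of two
   vertex distances plus 2, and for one of the two pairings these distances have
   the parity of [maxn m n - 1]. *)
Lemma joined_diam (p q : graph_point R e) : odd m -> joined p q (maxn m n)%:R.
Proof.
move=> m_odd.
have [u [u' [s [uu' u'u s01 -> _]]]] := point_on_edge p.
have [v [v' [t [vv' v'v t01 -> _]]]] := point_on_edge q.
have [u'n v'n] := (ltn_ord u'.2, ltn_ord v'.2).
set D := maxn m n; have [mD nD] : (m <= D /\ n <= D)%N by lia.
have DE : D%:R = D.-1%:R + 1 :> R by rewrite natr1 prednK //; lia.
have close (w w' : V) : odd (w.2 + w'.2) != odd D -> joined (vp w) (vp w') D.-1%:R.
  move=> ww'; have := ltn_ord w.2; have := ltn_ord w'.2 => w2 w'2.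
  by apply: joined_vertices => //; clear - ww' w2 w'2 mD nD; lia.
have [u'u_e s01' sE] := edge_flip uu' s01.
have [v'v_e t01' tE] := edge_flip vv' t01.
have [uvD|uvD] := eqVneq (odd (u.2 + v.2)) (odd D).
  have uv'D : odd (u.2 + v'.2) != odd D.
    by rewrite v'v addnS /= uvD; case: odd.
  have u'vD : odd (u'.2 + v.2) != odd D.
    by rewrite u'u /= uvD; case: odd.
  have [st|ts] := leP s t.
    rewrite tE; have := joined_through_edges uu' v'v_e s01 t01' (close _ _ uv'D).
    by apply: joinedW; lra.
  rewrite sE; have := joined_through_edges u'u_e vv' s01' t01 (close _ _ u'vD).
  by apply: joinedW; lra.
have u'v'D : odd (u'.2 + v'.2) != odd D.
  by rewrite u'u v'v addnS /= negbK.
have [st|ts] := leP (s + t) 1.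
  have := joined_through_edges uu' vv' s01 t01 (close _ _ uvD).
  by apply: joinedW; lra.
rewrite sE tE.
have := joined_through_edges u'u_e v'v_e s01' t01' (close _ _ u'v'D).
by apply: joinedW; lra.
Qed.

(** Leave [p] by the upper end of its edge and reach [q] by the lower end of its own. If these ends
    are at least m - 1 levels apart, the chain is exactly as long as the difference of levels;
    otherwise they are within [m], and the end pieces add at most 2. *)
Lemma joined_far (p q : graph_point R e) : odd m -> (2 <= m')%N ->
  joined p q (Num.max (m%:R + 2) `|level p - level q|).
Proof.
move=> m_odd m3; wlog pq : p q / level p <= level q.
  move=> far; have [|/ltW qp] := leP (level p) (level q); first exact: far.
  by rewrite distrC; apply/joined_sym/far.
have [u [u' [s [uu' u'u s01 pE hp]]]] := point_on_edge p.
have [v [v' [t [vv' v'v t01 qE hq]]]] := point_on_edge q.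
have [u'u_e s01' sE] := edge_flip uu' s01.
have := ltn_ord u.2; have := ltn_ord u'.2; have := ltn_ord v.2 => v2 u'2 u2.
have u'E : u'.2%:R = u.2%:R + 1 :> R by rewrite u'u natr1.
have uv : (u.2 <= v.2.+1)%N.
  by move: pq; rewrite hp hq -(ler_nat R) -natr1; lra.
have [far|close] := leqP (u'.2 + m') v.2.
  have u'v : (u'.2 <= v.2)%N by apply: leq_trans far; apply: leq_addr.
  have u'vj : joined (vp u') (vp v) (v.2 - u'.2)%:R.
    apply: joined_vertices => //; rewrite ?subnKC ?leq_addl //.
    - by rewrite leq_subRL.
    - by rewrite oddB // oddD addbC.
    - by apply: leq_trans u'v _; apply: leq_addr.
  rewrite hp hq pE qE sE.
  apply: joinedW (joined_through_edges u'u_e vv' s01' t01 u'vj).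
  rewrite le_max natrB // ler_normr u'E opprD !addrA.
  by apply/orP; right; apply/orP; right; lra.
(* The order of the levels of [p] and [q] still allows [u'] to be up to two levels above [v], and
   [m'] is at least 2. *)
have [u'v_le vu'_le] : (u'.2 <= v.2 + m')%N /\ (v.2 <= u'.2 + m')%N.
  by clear - m3 uv u'u close; lia.
have u'vj : joined (vp u') (vp v) m%:R.
  have [u'vM|u'vM] := eqVneq (odd (u'.2 + v.2)) (odd m).
    by apply: joined_vertices; rewrite ?addnS // leqW.
  apply: (@joinedW _ _ _ _ _ m'%:R); first by rewrite ler_nat.
  by apply: joined_vertices => //; move: u'vM => /=; do 2 case: odd.
rewrite pE qE sE; apply: joinedW (joined_through_edges u'u_e vv' s01' t01 u'vj).
by rewrite le_max; apply/orP; left; lra.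
Qed.
End Distance.
End CylinderGraph.

(** * Geodesics in a space with a distance *)

Section Geodesic.
Variables (R : realType) (X : Type) (d : X -> X -> R).

Lemma geodesic_refl x : d x x = 0 -> is_geodesic d x x [set x].
Proof.
move=> dxx; exists 0, (fun=> x); split=> //.
  by move=> s t s0 t0; rewrite dxx; have -> : s - t = 0 by [lra]; rewrite normr0.
by apply/seteqP; split=> [_ ->|_ [t _ <-]] //; exists 0; rewrite //= lexx.
Qed.

Lemma geodesic_sym x y S : is_geodesic d x y S -> is_geodesic d y x S.
Proof.
move=> [L [g [L0 <- <- gd ->]]]; exists L, (fun t => g (L - t)); split=> //.
- by rewrite subr0.
- by rewrite subrr.
- move=> s t sL tL; rewrite gd; [|lra|lra].
  by rewrite -normrN; congr (`|_|); ring.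
apply/seteqP; split=> _ [t /= tL <-]; exists (L - t); rewrite /= ?subKr //; lra.
Qed.

Lemma geodesic_ends x y S : is_geodesic d x y S -> S x /\ S y.
Proof.
move=> [L [g [L0 <- <- _ ->]]].
by split; [exists 0|exists L]; rewrite //= ?L0 lexx.
Qed.

Lemma geodesic_dist_ends x y S p : is_geodesic d x y S -> S p ->
  d p x + d p y = d x y.
Proof.
move=> [L [g [L0 <- <- gd ->]]] [t /= /andP[t0 tL] <-].
rewrite !gd ?lexx ?t0 ?tL ?L0 //.
rewrite subr0 sub0r normrN (ger0_norm t0) (ger0_norm L0) distrC.
by rewrite ger0_norm ?subr_ge0 //; ring.
Qed.
End Geodesic.

(** * Upper bound for the hyperbolicity constant *)

Section UpperBound.
Variables (R : realType) (m' n : nat).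
Local Notation m := m'.+1.
Local Notation V := ('I_m * 'I_n.+1)%type.
Local Notation e := (direct_product (@cycle_graph m) (@path_graph n.+1)).
Local Notation dist := (@graph_dist R V e).
Hypotheses (n_gt0 : (0 < n)%N) (m_odd : odd m) (m_ge3 : (2 <= m')%N).

Lemma level_dist p q : `|level p - level q| <= dist p q.
Proof. exact: lipschitz_dist (@level_lip _ _ R) (joined_diam n_gt0 p q m_odd). Qed.

Lemma geodesic_crosses x y S c : is_geodesic dist x y S ->
  Num.min (level x) (level y) <= c <= Num.max (level x) (level y) ->
  exists2 q, S q & level q = c.
Proof.
move=> [L [g [L0 <- <- gd ->]]] xyc.
have [|t tL tc] := @lipschitz_IVT _ (fun t => level (g t)) L c L0 _ xyc.
  by move=> s t sL tL; rewrite -(gd s t sL tL); apply: level_dist.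
by exists (g t) => //; exists t.
Qed.

(** On an edge the level runs strictly from one integer to the next, so an integer value occurs only
    at the ends. *)
Lemma level_vertex (p : graph_point R e) (k : nat) : level p = k%:R ->
  exists2 v : V, p = vertex_point R e v & v.2 = k :> nat.
Proof.
have [u [u' [s [uu' u'u s01 pE ->]]]] := point_on_edge n_gt0 p => usk.
have [ku|uk] := leqP k u.2.
  have ku' : k%:R <= u.2%:R :> R by rewrite ler_nat.
  have s0 : s = 0 by lra.
  exists u; first by rewrite pE s0 edge_point0.
  by apply/eqP; rewrite -(eqr_nat R) -usk s0 addr0.
have uk' : u'.2%:R <= k%:R :> R by rewrite ler_nat u'u.
rewrite u'u -natr1 in uk'; have s1 : s = 1 by lra.
exists u'; first by rewrite pE s1 edge_point1.
by apply/eqP; rewrite -(eqr_nat R) -usk s1 u'u natr1.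
Qed.

Let K := maxn m (minn n (2 * m).-1)%N.

Lemma side_thin x1 x2 x3 A B C : is_geodesic dist x1 x2 A ->
  is_geodesic dist x2 x3 B -> is_geodesic dist x3 x1 C ->
  in_neighborhood dist (K%:R / 2) A (B `|` C).
Proof.
move=> gA gB gC p Ap; have [Bx2 Bx3] := geodesic_ends gB.
have [Cx3 Cx1] := geodesic_ends gC.
have dp := geodesic_dist_ends gA Ap.
have [near1|far1] := leP (dist p x1) (K%:R / 2); first by exists x1; [right|].
have [near2|far2] := leP (dist p x2) (K%:R / 2); first by exists x2; [left|].
(* From here [p] is farther than [K / 2] from both ends of the side, which is thus longer than [K].
   This forces [n] to be at least 2m, so [K] is 2m - 1. *)
have Kn : (K < maxn m n)%N.
  rewrite -(ltr_nat R); apply: (@lt_le_trans _ _ (dist x1 x2)); first by lra.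
  by apply: graph_dist_le; apply: joined_diam.
have KE : K%:R = 2 * m'%:R + 1 :> R.
  have -> : K = (2 * m' + 1)%N by rewrite /K in Kn *; lia.
  by rewrite natrD natrM.
have m2 : 2 <= m'%:R :> R by rewrite ler_nat.
(* Since [m] is at least 3, 2m - 1 is at least m + 2, which leaves only the second term of the
   maximum in [joined_far]. *)
have l12 : dist x1 x2 <= `|level x1 - level x2|.
  have /graph_dist_le := joined_far n_gt0 x1 x2 m_odd m_ge3.
  by rewrite le_max -natr1 => /orP[] //; lra.
have [w pw wp] : exists2 w : V, joined p (vertex_point R e w) (1 / 2) &
    `|level p - w.2%:R| <= 1 / 2.
  have [u [u' [s [uu' u'u s01 -> ->]]]] := point_on_edge n_gt0 p.
  have nuu' := edge_neq (@product_irr m' n) uu'.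
  have [s12|s12] := leP s (1 / 2).
    exists u; first exact: joinedW (joined_edge_left _ _ _).
    by rewrite ler_norml; lra.
  exists u'; first by apply: joinedW (joined_edge_right _ _ _); rewrite //; lra.
  by rewrite u'u -natr1 ler_norml; lra.
have lp1 := level_dist p x1; have lp2 := level_dist p x2.
(* The level changes as much as the length along the side, so the level of [p] is more than [K / 2]
   away from those of both ends, while [w] is within 1/2 of it. *)
have wx12 : Num.min (level x1) (level x2) <= w.2%:R <= Num.max (level x1) (level x2).
  move: wp lp1 lp2 l12; rewrite ge_min le_max !ler_norml ler_normr.
  by case: (leP (level x1) (level x2)) => ? ? ? ? /orP[] ?; lra.
(* [B] and [C] lead from [x2] to [x1] through [x3]; the level of [x3] decides which of them crosses
   that of [w]. *)
have [q BCq lq] : exists2 q, (B `|` C) q & level q = w.2%:R.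
  move: wx12; rewrite ge_min le_max.
  have crossB := geodesic_crosses (c := w.2%:R) gB.
  have crossC := geodesic_crosses (c := w.2%:R) gC.
  rewrite !ge_min !le_max in crossB crossC => /andP[].
  have [x3w|wx3] := leP (level x3) w.2%:R; have [x1w|wx1] := leP (level x1) w.2%:R.
  - move=> _ /orP[wx1|wx2].
      by have [|q] := crossC; [rewrite x3w wx1 orbT|exists q; [right|]].
    by have [|q] := crossB; [rewrite x3w wx2 orbT|exists q; [left|]].
  - by have [|q] := crossC; [rewrite x3w (ltW wx1) orbT|exists q; [right|]].
  - by have [|q] := crossC; [rewrite x1w (ltW wx3) orbT|exists q; [right|]].
  - move=> /= x2w _; have [|q] := crossB; last by exists q; [left|].
    by rewrite x2w (ltW wx3) orbT.
have [v qE vw] := level_vertex lq.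
(* [m'] is even, as is the sum of two equal levels. Adding 1/2 for the way from [p] to [w] gives m -
   1/2, which is [K / 2]. *)
have wv : joined (vertex_point R e w) (vertex_point R e v) m'%:R.
  apply: joined_vertices => //; rewrite ?vw ?leq_addr //.
  by rewrite addnn odd_double; move: m_odd => /=; case: odd.
exists q => //; apply: graph_dist_le; rewrite qE.
by apply: joinedW (joined_trans pw wv); lra.
Qed.

Lemma hyperbolicity_constant_le :
  (hyperbolicity_constant dist <= (K%:R / 2)%:E)%E.
Proof.
apply/ereal_supP => _ [x1 [x2 [x3 [A [B [C [gA gB gC ->]]]]]]].
apply: ereal_inf_lbound; exists (K%:R / 2) => //; split; first by rewrite divr_ge0.
split; [exact: side_thin gA gB gC|exact: side_thin gB gC gA|].
exact: side_thin gC gA gB.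
Qed.
End UpperBound.

(** * Lower bound from a geodesic bigon around the cylinder *)

Section LowerBound.
Variables (R : realType) (m' n k : nat).
Local Notation m := m'.+1.
Local Notation V := ('I_m * 'I_n.+1)%type.
Local Notation e := (direct_product (@cycle_graph m) (@path_graph n.+1)).
Local Notation dist := (@graph_dist R V e).
Hypotheses (n_gt0 : (0 < n)%N) (m_odd : odd m) (m_ge3 : (2 <= m')%N).
Hypotheses (mk : (m <= k)%N) (k2m : (k < 2 * m)%N) (kmn : (k <= n)%N \/ k = m).

(* For [n < k], which forces [k = m], the walks zigzag between levels 0 and 1. *)
Definition height i : nat := if (k <= n)%N then i else odd i.

Definition forward_walk i : V := vertex_at m' n i (height i).

(* Descends from [2m], which is position 0, to [k], then spends the remaining
   steps alternating between [k] and [k + 1]. *)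
Definition turn_back i : nat :=
  (if i < 2 * m - k then 2 * m - i else k + odd (i + k))%N.

Definition backward_walk i : V := vertex_at m' n (turn_back i) (height i).

Lemma height_le i : (i <= k)%N -> (height i <= n)%N.
Proof.
rewrite /height; case: ifP => [kn ik|_ _]; first exact: leq_trans kn.
by apply: leq_trans n_gt0; case: odd.
Qed.

Lemma heightS i : height i.+1 = (height i).+1 \/ height i = (height i.+1).+1.
Proof. by rewrite /height; case: ifP => _ /=; [left|case: odd; [right|left]]. Qed.

Lemma odd_height i : odd (height i) = odd i.
Proof. by rewrite /height; case: ifP => // _; rewrite oddb. Qed.

Lemma turn_backS i :
  turn_back i.+1 = (turn_back i).+1 \/ turn_back i = (turn_back i.+1).+1.
Proof.
rewrite /turn_back; case: (ssrnat.ltngtP i.+1 (2 * m - k)) => ik.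
- by right; clear - k2m ik; lia.
- by rewrite addSn /=; case: odd => /=; rewrite ?addn0 ?addn1; [right|left].
(* At the switch between the two formulas the descent reaches exactly [k], because [i.+1 + k] is 2m,
   an even number. *)
- rewrite ik subnK ?(ltnW k2m) // oddM /= addn0; right; clear - k2m ik; lia.
Qed.

Lemma odd_turn_back i : (i <= k)%N -> odd (turn_back i) = odd i.
Proof.
move=> ik; rewrite /turn_back; case: ltnP => ik2.
  by rewrite oddB ?oddM //; clear - ik2; lia.
by rewrite oddD oddb oddD; case: (odd i); case: (odd k).
Qed.

Lemma turn_back_range i : (k <= turn_back i <= 2 * m)%N.
Proof.
rewrite /turn_back; case: ltnP => ik; first by clear - ik k2m; lia.
by case: odd => /=; clear - k2m; lia.
Qed.

Lemma vertex_at_edge2 a a' b b' : (b <= n)%N -> (b' <= n)%N ->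
  a' = a.+1 \/ a = a'.+1 -> b' = b.+1 \/ b = b'.+1 ->
  e (vertex_at m' n a b) (vertex_at m' n a' b').
Proof.
move=> bn b'n [->|->] bb'; first exact: vertex_at_edge.
by rewrite product_sym; apply: vertex_at_edge => //; case: bb'; [right|left].
Qed.

Lemma forward_walk_edge i : (i < k)%N -> e (forward_walk i) (forward_walk i.+1).
Proof.
move=> ik; apply: vertex_at_edge; rewrite ?height_le ?(ltnW ik) //.
exact: heightS.
Qed.

Lemma backward_walk_edge i : (i < k)%N -> e (backward_walk i) (backward_walk i.+1).
Proof.
move=> ik; apply: vertex_at_edge2; rewrite ?height_le ?(ltnW ik) //.
  exact: turn_backS.
exact: heightS.
Qed.

Lemma position_forward i : (i <= k)%N -> position (forward_walk i) = i.
Proof.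
move=> ik; apply: position_vertex_at => //; rewrite ?height_le ?odd_height //.
exact: leq_ltn_trans k2m.
Qed.

Lemma vertex_at_wrap b : vertex_at m' n (2 * m) b = vertex_at m' n 0 b.
Proof. by rewrite /vertex_at modnMl mod0n. Qed.

Lemma position_backward i : (i <= k)%N -> position (backward_walk i) =
  if turn_back i == (2 * m)%N then 0%N else turn_back i.
Proof.
move=> ik; rewrite /backward_walk; have hi := height_le ik.
have /andP[_ i2m] := turn_back_range i.
have oi : odd (turn_back i) = odd (height i) by rewrite odd_height odd_turn_back.
case: eqVneq => [iE|i_neq]; last first.
  by apply: position_vertex_at => //; rewrite ltn_neqAle i_neq.
rewrite iE vertex_at_wrap.
by apply: position_vertex_at => //; rewrite -oi iE oddM.
Qed.

Lemma backward_walk0 : backward_walk 0 = forward_walk 0.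
Proof.
rewrite /backward_walk /forward_walk /turn_back subn_gt0 k2m subn0.
by rewrite vertex_at_wrap.
Qed.

Lemma backward_walk_end : backward_walk k = forward_walk k.
Proof.
rewrite /backward_walk /forward_walk /turn_back ifF; last by clear - mk; lia.
by rewrite addnn odd_double addn0.
Qed.

Lemma natr_dist_le1 a b : (a <= b.+1)%N -> (b <= a.+1)%N ->
  `|a%:R - b%:R| <= 1 :> R.
Proof. by rewrite -!(ler_nat R) -!natr1 ler_norml; lra. Qed.

Lemma walk_height : exists f : V -> R,
  [/\ forall u v, e u v -> `|f u - f v| <= 1,
      forall i, (i <= k)%N -> f (forward_walk i) = 0 + i%:R &
      forall i, (i <= k)%N -> f (backward_walk i) = 0 + i%:R].
Proof.
have [kn|nk] := leqP k n.
  exists (fun u : V => u.2%:R).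
  have hE i : (i <= k)%N -> height i = i by rewrite /height kn.
  split=> [u v|i ik|i ik]; first exact: level_edge_lip.
    by rewrite add0r /= inordK ?hE // ltnS (leq_trans ik).
  by rewrite add0r /= inordK ?hE // ltnS (leq_trans ik).
have km : k = m by case: kmn nk => // kn; rewrite ltnNge kn.
exists (fun u : V => (minn (position u) (2 * m - position u))%:R).
split=> [u v uv|i ik|i ik].
- have := edge_position m_odd uv; clear.
  by case=> [||[]|[]] *; apply: natr_dist_le1; lia.
- by rewrite position_forward // add0r; congr _%:R; clear - ik k2m km; lia.
rewrite position_backward // /turn_back add0r; congr _%:R.
have -> : (2 * m - k = k)%N by clear - km; lia.
case: (ssrnat.ltngtP i k) ik => // [ik _|-> _].
  by case: eqP; clear - ik km; lia.
by rewrite addnn odd_double addn0 km; case: eqP; clear; lia.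
Qed.

(** Goes from -k/2 at position 0 to k/2 at position [k] and stays there up to 2m - 1: the absolute
    value vanishes at the middle of the forward way and is k/2 on the vertices of the backward
    way. *)
Definition signed_position (u : V) : R := (minn (position u) k)%:R - k%:R / 2.

(* [signed_position] jumps between positions [2m - 1] and 0: on these edges its
   interpolation is meaningless and [far_from_middle] is constant. *)
Definition across_cut (p : graph_point R e) :=
  [exists u, [exists v, [&& val p u != 0, val p v != 0,
                            position u == 0%N & position v == (2 * m).-1]]].

Definition far_from_middle (p : graph_point R e) : R :=
  if across_cut p then k%:R / 2 else `|interpolate signed_position p|.

Lemma far_from_middle_uncut u v t : e u v -> 0 <= t <= 1 ->
  position v = (position u).+1 \/ position u = (position v).+1 ->
  far_from_middle (edge_point e u v t) =
  `|(1 - t) * signed_position u + t * signed_position v|.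
Proof.
move=> uv t01 pos; rewrite /far_from_middle ifF.
  by rewrite interpolate_edge_point.
rewrite /across_cut; apply/existsP => -[w /existsP[w' /and4P[]]].
have supp x : val (edge_point e u v t) x != 0 -> x = u \/ x = v.
  rewrite val_edge_point ?uv ?orbT // ffunE.
  case: (eqVneq x u) => [->|_]; first by left.
  case: (eqVneq x v) => [->|_]; first by right.
  by rewrite !mulr0 addr0 eqxx.
(* The positions 0 and 2m - 1 are neither equal nor consecutive. *)
by move=> /supp[]-> /supp[]-> /eqP + /eqP; move: pos; clear - m_ge3; lia.
Qed.

Lemma far_from_middle_cut u v t : e u v -> 0 <= t <= 1 ->
  position u = 0%N -> position v = (2 * m).-1 ->
  far_from_middle (edge_point e u v t) = k%:R / 2.
Proof.
move=> uv t01 u0 vm; rewrite /far_from_middle; case: ifP => // cut.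
have nuv := edge_neq (@product_irr m' n) uv.
have k_ge0 : 0 <= k%:R / 2 :> R by rewrite divr_ge0.
have su : signed_position u = - (k%:R / 2).
  by rewrite /signed_position u0 min0n sub0r.
have sv : signed_position v = k%:R / 2.
  rewrite /signed_position vm (minn_idPr _); last by clear - k2m; lia.
  by field.
rewrite interpolate_edge_point // su sv.
(* The ends of the edge are not [across_cut], but there [signed_position] is -k/2 and k/2, so the
   absolute value agrees with the constant. *)
have [t0|t_neq0] := eqVneq t 0.
  by rewrite t0 subr0 mul1r mul0r addr0 normrN ger0_norm.
have [t1|t_neq1] := eqVneq t 1.
  by rewrite t1 subrr mul1r mul0r add0r ger0_norm.
suff : across_cut (edge_point e u v t) by rewrite cut.
apply/existsP; exists u; apply/existsP; exists v.
rewrite u0 vm !eqxx !val_edge_point ?uv ?orbT // !ffunE !eqxx (negPf nuv).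
rewrite (eq_sym v) (negPf nuv) !mulr1 !mulr0 addr0 add0r subr_eq0.
by rewrite (eq_sym 1) t_neq1 t_neq0.
Qed.

(* Rewriting directly with two equations about points of one edge makes
   unification compare the points by unfolding them, which does not end. *)
Lemma dist_congr (a b c d : R) : a = c -> b = d -> `|a - b| = `|c - d|.
Proof. by move=> -> ->. Qed.

Lemma far_from_middle_lip : edgewise_lipschitz far_from_middle.
Proof.
apply: edgewise_lipschitzP => [|u v s t uv s01 t01]; first exact: product_irr.
have uncut : position v = (position u).+1 \/ position u = (position v).+1 ->
    `|far_from_middle (edge_point e u v s) - far_from_middle (edge_point e u v t)|
    <= `|s - t|.
  move=> pos; rewrite (dist_congr (far_from_middle_uncut uv s01 pos)
                                 (far_from_middle_uncut uv t01 pos)).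
  apply: le_trans (ler_dist_dist _ _) _.
  have -> : (1 - s) * signed_position u + s * signed_position v -
      ((1 - t) * signed_position u + t * signed_position v) =
      - ((s - t) * (signed_position u - signed_position v)) by ring.
  rewrite normrN normrM ler_piMr // /signed_position opprB addrA subrK.
  by apply: natr_dist_le1; move: pos; clear; lia.
case: (edge_position m_odd uv) => [vu|uv'|[u0 vm]|[v0 um]].
- by apply: uncut; left.
- by apply: uncut; right.
- rewrite (dist_congr (far_from_middle_cut uv s01 u0 vm)
                      (far_from_middle_cut uv t01 u0 vm)).
  by rewrite subrr normr0.
have [vu s01' ->] := edge_flip uv s01; have [_ t01' ->] := edge_flip uv t01.
rewrite (dist_congr (far_from_middle_cut vu s01' v0 um)
                    (far_from_middle_cut vu t01' v0 um)).
by rewrite subrr normr0.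
Qed.

Lemma far_from_middle_forward :
  far_from_middle (walk_point e forward_walk k (k%:R / 2)) = 0.
Proof.
have k_gt0 : (0 < k)%N by apply: leq_trans mk.
have k_half : 0 <= (k%:R / 2 : R) <= k%:R.
  by have k0 := ler0n R k; lra.
have fE : interpolate signed_position (walk_point e forward_walk k (k%:R / 2)) = 0.
  rewrite (interpolate_walk_point forward_walk_edge (c := - (k%:R / 2))) ?addNr //.
  by move=> i ik; rewrite /signed_position position_forward // (minn_idPl ik) addrC.
(* For odd [k] the middle lies inside an edge; in any case its edge joins consecutive positions and
   avoids the cut. *)
have [i [s [ltik s01 _ pE]]] := walk_point_ex e forward_walk k_gt0 k_half.
rewrite pE in fE *.
rewrite far_from_middle_uncut ?forward_walk_edge //.
  by rewrite interpolate_edge_point ?forward_walk_edge // in fE; rewrite fE normr0.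
by left; rewrite !position_forward // ltnW.
Qed.

Lemma far_from_middle_backward t : 0 <= t <= k%:R ->
  far_from_middle (walk_point e backward_walk k t) = k%:R / 2.
Proof.
move=> tk; have k_gt0 : (0 < k)%N by apply: leq_trans mk.
have k_ge0 : 0 <= k%:R / 2 :> R by rewrite divr_ge0.
have [i [s [ltik s01 _ ->]]] := walk_point_ex e backward_walk k_gt0 tk.
have uv := backward_walk_edge ltik.
have pos j : (j <= k)%N -> position (backward_walk j) = 0%N \/
    (k <= position (backward_walk j))%N.
  move=> jk; rewrite position_backward //; case: ifP => _; [by left|right].
  by case/andP: (turn_back_range j).
have uncut : position (backward_walk i.+1) = (position (backward_walk i)).+1 \/
    position (backward_walk i) = (position (backward_walk i.+1)).+1 ->
    far_from_middle (edge_point e (backward_walk i) (backward_walk i.+1) s) =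
    k%:R / 2.
  move=> posS; rewrite far_from_middle_uncut //.
  (* Position 0 is excluded: its consecutive neighbour would be 1, less than [k]. *)
  have [ki ki1] : (k <= position (backward_walk i))%N /\
      (k <= position (backward_walk i.+1))%N.
    have := pos i (ltnW ltik); have := pos i.+1 ltik.
    by move: posS; clear - mk m_ge3; lia.
  rewrite /signed_position (minn_idPr ki) (minn_idPr ki1) -mulrDl subrK mul1r.
  by rewrite [X in X - _]splitr addrK ger0_norm.
case: (edge_position m_odd uv) => [vu|uv'|[u0 vm]|[v0 um]].
- by apply: uncut; left.
- by apply: uncut; right.
- exact: far_from_middle_cut.
have [vu s01' ->] := edge_flip uv s01; exact: far_from_middle_cut.
Qed.

Lemma hyperbolicity_constant_ge :
  ((k%:R / 2)%:E <= hyperbolicity_constant dist)%E.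
Proof.
have k_gt0 : (0 < k)%N by apply: leq_trans mk.
have [f [fL ff fb]] := walk_height.
have gA := walk_geodesic (@product_irr m' n) forward_walk_edge fL k_gt0 ff.
have gC := walk_geodesic (@product_irr m' n) backward_walk_edge fL k_gt0 fb.
rewrite backward_walk0 backward_walk_end in gC.
have [_ Cx2] := geodesic_ends gC.
(* The bigon is made a triangle by a constant side at the common end. *)
have gB := geodesic_refl (graph_dist_refl (vertex_point R e (forward_walk k))).
apply: le_trans (ereal_sup_ubound _); last first.
  by do 6 eexists; split; [exact: gA|exact: gB|exact: geodesic_sym gC|reflexivity].
apply/ereal_infP => _ [r [_ [thinA _ _]] <-]; rewrite lee_fin.
pose p := walk_point e forward_walk k (k%:R / 2 : R).
have [|q Bq pq] := thinA p.
  by exists (k%:R / 2) => //=; have k0 := ler0n R k; lra.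
have [t tk qE] : exists2 t, 0 <= t <= k%:R & walk_point e backward_walk k t = q.
  by case: Bq => [->|//]; case: Cx2 => t tk <-; exists t.
apply: le_trans pq.
apply: le_trans (lipschitz_dist far_from_middle_lip (joined_diam n_gt0 p q m_odd)).
rewrite far_from_middle_forward -qE far_from_middle_backward // sub0r normrN.
exact: ler_norm.
Qed.
End LowerBound.

(** * The three cases read off from the common value [k / 2] *)

Theorem theorem3p7 (R : realType) (m n : nat) :
  odd m -> (3 <= m)%N -> (2 <= n)%N ->
  hyperbolicity_constant
    (@graph_dist R _ (direct_product (@cycle_graph m) (@path_graph n))) =
  (if (n - 1 <= m)%N then (m%:R / 2)%:E
   else if (n - 1 < 2 * m)%N then ((n - 1)%N%:R / 2)%:E
   else (m%:R - 1 / 2)%:E).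
Proof.
(* From here [n] is the highest level, one less than the number of vertices of the path. *)
case: m n => // m' [] // n m_odd m3 n2.
pose k := maxn m'.+1 (minn n (2 * m'.+1).-1)%N.
transitivity ((k%:R / 2 : R)%:E).
  apply/eqP; rewrite eq_le hyperbolicity_constant_le //=.
  by apply: hyperbolicity_constant_ge => //; rewrite /k; clear - m3; lia.
rewrite subn1 /=; case: (leqP n m'.+1) => [nm|mn].
  by have -> : k = m'.+1 by rewrite /k; clear - nm m3; lia.
case: ltnP => [nm|mn2].
  by have -> : k = n by rewrite /k; clear - nm mn; lia.
have -> : k = (2 * m'.+1).-1 by rewrite /k; clear - mn2 m3; lia.
have kE : (2 * m'.+1).-1%:R + 1 = 2 * m'.+1%:R :> R by rewrite natr1 prednK ?natrM.
by congr (_%:E); lra.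
Qed.
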